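(* Let $K$ be a field of characteristic $2$. Let $F|K=K(z,y)|K$ be a function field of transcendence degree $1$ with $$y^4 + a z^4 + b y^2 + c z^2 + b z + d = 0,$$ where $a,b,c,d\in K$, $a\notin K^2$, $b\neq 0$, and let $F'|K=K(z',y')|K$ be another such function field, with constants $a',b',c',d'\in K$, $a'\notin K^2$, $b'\neq0$, i.e. $y'^4 + a' z'^4 + b' y'^2 + c' z'^2 + b' z' + d' = 0$. Then the $K$-isomorphisms $F' \overset \sim \to F$ are given by $$(z',y') \mapsto ( \varepsilon^2 (z + \beta), \varepsilon (y + \tau + \gamma z) ),$$ where $\varepsilon,\beta,\tau,\gamma \in K$ satisfy $\varepsilon \neq 0$, $\varepsilon^4 a' = a + \gamma^4$, $\varepsilon^{-2} b' = b$, $c' = c + \gamma^2 b$, $\varepsilon^{-4} d' = d + \beta^4 (\gamma^4 + a) + \beta^2 c + \tau^4 + ( \beta^2 \gamma^2 + \beta + \tau^2) b$. The automorphisms of $F|K$ are given by $$(z,y) \mapsto (z + \beta, y + \tau),$$ where $\beta,\tau \in K$ satisfy $\beta^4 a + \beta^2 c + \tau^4 + ( \beta + \tau^2) b = 0$.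
   Context: $K^2=\{t^2:t\in K\}$. Isomorphisms and automorphisms are $K$-isomorphisms of fields. *)

(* Defs.v *)
From HB Require Import structures.
From mathcomp Require Import all_boot all_order all_algebra.

Set Implicit Arguments.
Unset Strict Implicit.
Unset Printing Implicit Defensive.

Import GRing.Theory.
Local Open Scope ring_scope.

(* A field extension F|K, not necessarily finite, is a field F together with
   a ring morphism iota : K -> F. *)

Section Extension.
Variables (K F : fieldType) (iota : {rmorphism K -> F}).

(* [adjoin S x] means x \in K(S), the smallest subfield of F containing
   iota(K) and S. *)
Inductive adjoin (S : F -> Prop) : F -> Prop :=
| adjoin_base (k : K) : adjoin S (iota k)
| adjoin_gen (x : F) : S x -> adjoin S x
| adjoin_add (u v : F) : adjoin S u -> adjoin S v -> adjoin S (u + v)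
| adjoin_opp (u : F) : adjoin S u -> adjoin S (- u)
| adjoin_mul (u v : F) : adjoin S u -> adjoin S v -> adjoin S (u * v)
| adjoin_inv (u : F) : adjoin S u -> adjoin S u^-1.

Definition generated_by (s : seq F) : Prop :=
  forall u : F, adjoin (fun x => x \in s) u.

Definition algebraic_over_subset (E : F -> Prop) (u : F) : Prop :=
  exists p : {poly F}, [/\ p != 0, forall i : nat, E p`_i & root p u].

(* {x} is a transcendence basis of F|K for some x *)
Definition transcendence_degree_one : Prop :=
  exists x : F, ~ algebraicOver iota x /\
    forall u : F, algebraic_over_subset (adjoin (fun w => w = x)) u.

Definition function_field_one : Prop :=
  (exists s : seq F, generated_by s) /\ transcendence_degree_one.

(* F|K = K(z,y)|K is a function field of transcendence degree 1 with
   y^4 + a z^4 + b y^2 + c z^2 + b z + d = 0, a \notin K^2, b <> 0;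
   y^2 and z carry the same coefficient b. *)
Record quartic_function_field (a b c d : K) (z y : F) : Prop :=
  QuarticFunctionField {
    quartic_function_field_one : function_field_one;
    quartic_generated : generated_by [:: z; y];
    quartic_eq : y ^+ 4 + iota a * z ^+ 4 + iota b * y ^+ 2
                 + iota c * z ^+ 2 + iota b * z + iota d = 0;
    quartic_a_nonsquare : ~ (exists t : K, a = t ^+ 2);
    quartic_b_neq0 : b != 0 }.

End Extension.

Definition K_isomorphism (K F' F : fieldType) (iota' : {rmorphism K -> F'})
    (iota : {rmorphism K -> F}) (phi : {rmorphism F' -> F}) : Prop :=
  bijective phi /\ forall k : K, phi (iota' k) = iota k.

(* phi is a K-isomorphism F' -> F with (z', y') |-> (u, v) *)
Definition K_isomorphism_with (K F' F : fieldType)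
    (iota' : {rmorphism K -> F'}) (iota : {rmorphism K -> F})
    (z' y' : F') (u v : F) (phi : {rmorphism F' -> F}) : Prop :=
  [/\ K_isomorphism iota' iota phi, phi z' = u & phi y' = v].

Definition isomorphism_parameters (K : fieldType)
    (a b c d a' b' c' d' eps beta tau gamma : K) : Prop :=
  [/\ eps != 0,
      eps ^+ 4 * a' = a + gamma ^+ 4,
      eps ^- 2 * b' = b,
      c' = c + gamma ^+ 2 * b &
      eps ^- 4 * d' = d + beta ^+ 4 * (gamma ^+ 4 + a) + beta ^+ 2 * c
        + tau ^+ 4 + (beta ^+ 2 * gamma ^+ 2 + beta + tau ^+ 2) * b].

Definition automorphism_parameters (K : fieldType)
    (a b c beta tau : K) : Prop :=
  beta ^+ 4 * a + beta ^+ 2 * c + tau ^+ 4 + (beta + tau ^+ 2) * b = 0.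

(* Main.v *)
Require Import Defs.
From HB Require Import structures.
From mathcomp Require Import all_boot all_order all_algebra ring zify.

Set Implicit Arguments.
Unset Strict Implicit.
Unset Printing Implicit Defensive.

Import GRing.Theory.
Local Open Scope ring_scope.

(** The fields [K(F^2)], [K(F^4)] and [K(F^8)] depend on [F|K] alone, and the
last one is a rational function field: it is [K(r)] with
[r = y^4 + a z^4 + z^2 + d = b y^2 + (c+1) z^2 + b z] ([frobgen]).  Over [K(r)]
the field [F] is purely inseparable of degree 8: with
[e = b^2 a + (c+1)^2] one has [z^4 = q(r)] and [y^8 = w(r)], where
[q = (X^2 + b^2 X + b^2 d)/e] and [w = a^2 q^2 + q + X^2 + d^2].

Hence an element of [F] is studied through its fourth or eighth power, which
is an explicit combination of squares in [K(r)], and two facts about such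
combinations carry the proof.  Since [q] and [w] have a nonzero constant
derivative and squares have derivative zero, divisibility of a combination by
a square forces divisibility of its terms ([dvdp_sqr_comb]): the ring
[K[r][z,y]] is integrally closed ([frob1_integral], [F_integral]).  Since [a]
is not a square, neither is [e], nor the leading coefficient [1/e] of [q], so
that leading terms cannot cancel and degrees in [r] are read off termwise
([size_sqr_comb], [size_pow8]).

Let [phi : F' -> F] be an isomorphism.  As it maps [K(F'^8)] onto [K(F^8)],
the element [phi r'] is a Moebius transform [f(r)/g(r)] of [r] ([moebius]).
Clearing denominators in [(phi z')^4 = q'(phi r')], the element
[g(r) phi z'] of [K(F^2)] has a fourth power in [K[r]] of degree at most 4;
all such polynomials have a constant derivative, whereas here the derivative is
a multiple of [g^2], so that [g] is constant ([iso_frobgen_affine]).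
Geometrically, [phi] preserves the only nonsmooth place, the pole of [z].
Then [(phi z')^4] and [(phi y')^8] are polynomials in [r] of degree at most 2
and 4, and the degree bounds leave only [phi z'] in [K + K z] and [phi y'] in
[K + K z + K y] ([iso_linear]).  Substituting in the quartic equation and
comparing coefficients gives the parameters ([iso_parameters]).

Conversely, [P(z,y)^8] is a polynomial in [r] computed from [P, a, b, c, d]
alone, so that the algebraic relations between [z] and [y] do not depend on the
function field ([pow8_ev2]).  Two function fields with the same constants are
therefore isomorphic by a unique isomorphism matching the generators
([quartic_isomorphism]); it is applied to the transformed generators of [F],
which satisfy the equation of [F']. *)

(** * Computing in characteristic two *)

Lemma natr_even_pchar2 (R : nzRingType) n :
  2%N \in [pchar R] -> (n.*2)%:R = 0 :> R.
Proof. by move=> h; rewrite -mul2n natrM (pcharf0 h) mul0r. Qed.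

Lemma oppr_natr_even_pchar2 (R : nzRingType) n :
  2%N \in [pchar R] -> - (n.*2)%:R = 0 :> R.
Proof. by move=> h; rewrite natr_even_pchar2 ?oppr0. Qed.

(* [ring] and [field] use an equation with a constant left-hand side only on
   coefficients equal to that constant, so each even coefficient that occurs
   is given its own equation. *)
Ltac char2_with tac h :=
  apply/eqP; rewrite -subr_eq0; apply/eqP;
  let p1 := fresh in let p2 := fresh in let p3 := fresh in
  let p4 := fresh in let p6 := fresh in
  let n1 := fresh in let n2 := fresh in let n3 := fresh in
  let n4 := fresh in let n6 := fresh in
  have p1 := natr_even_pchar2 1 h; have p2 := natr_even_pchar2 2 h;
  have p3 := natr_even_pchar2 3 h; have p4 := natr_even_pchar2 4 h;
  have p6 := natr_even_pchar2 6 h;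
  have n1 := oppr_natr_even_pchar2 1 h; have n2 := oppr_natr_even_pchar2 2 h;
  have n3 := oppr_natr_even_pchar2 3 h; have n4 := oppr_natr_even_pchar2 4 h;
  have n6 := oppr_natr_even_pchar2 6 h;
  rewrite /double /= in p1 p2 p3 p4 p6 n1 n2 n3 n4 n6;
  tac p1 p2 p3 p4 p6 n1 n2 n3 n4 n6;
  clear p1 p2 p3 p4 p6 n1 n2 n3 n4 n6.
Tactic Notation "char2_ring" constr(h) :=
  char2_with ltac:(fun p1 p2 p3 p4 p6 n1 n2 n3 n4 n6 =>
    ring: p1 p2 p3 p4 p6 n1 n2 n3 n4 n6) h.
Tactic Notation "char2_field" constr(h) :=
  char2_with ltac:(fun p1 p2 p3 p4 p6 n1 n2 n3 n4 n6 =>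
    field: p1 p2 p3 p4 p6 n1 n2 n3 n4 n6) h.

Section Char2.
Variables (R : idomainType) (charR2 : 2%N \in [pchar R]).

Lemma sqrD_pchar2 (x y : R) : (x + y) ^+ 2 = x ^+ 2 + y ^+ 2.
Proof. by char2_ring charR2. Qed.

Lemma addr_eq0_pchar2 (x y : R) : (x + y == 0) = (x == y).
Proof. by rewrite addr_eq0; congr (_ == _); char2_ring charR2. Qed.

Lemma sqr_inj_pchar2 (x y : R) : x ^+ 2 = y ^+ 2 -> x = y.
Proof.
move/eqP; rewrite -addr_eq0_pchar2 -sqrD_pchar2 expf_eq0 /=.
by rewrite addr_eq0_pchar2 => /eqP.
Qed.

End Char2.

(** * Combinations of two squares of polynomials *)

Section SquareCombinations.
Variables (K : fieldType) (charK2 : 2%N \in [pchar K]).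
Implicit Types f g h : {poly K}.

Let charP2 : 2%N \in [pchar {poly K}].
Proof. by rewrite pchar_poly. Qed.

Lemma deriv_sqr f : (f ^+ 2)^`() = 0.
Proof. by rewrite expr2 derivM mulrC; char2_ring charP2. Qed.

(** Squares have derivative zero, so differentiating a multiple of [g ^+ 2]
gives a multiple of [g ^+ 2], and differentiating [f0 ^+ 2 + f1 ^+ 2 * h]
isolates [f1 ^+ 2].  For [g = 0] this is the independence of [1] and [h] over
the squares. *)
Lemma dvdp_sqr_comb g f0 f1 h (k : K) :
  k != 0 -> h^`() = k%:P -> g ^+ 2 %| f0 ^+ 2 + f1 ^+ 2 * h ->
  g %| f0 /\ g %| f1.
Proof.
move=> k0 dh dvd.
have dvd1 : g %| f1.
  rewrite -(dvdp_pexp2r _ _ (ltn0Sn 1)).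
  case/dvdpP: (dvd) => u /(congr1 (@deriv K)).
  rewrite derivD [(f1 ^+ 2 * h)^`()]derivM [(u * _)^`()]derivM !deriv_sqr dh.
  rewrite mul0r mulr0 !add0r addr0 => E.
  have -> : f1 ^+ 2 = k^-1%:P * u^`() * g ^+ 2.
    by rewrite -mulrA -E mulrCA -polyCM mulVf ?mulr1.
  exact: dvdp_mulIr.
split=> //; rewrite -(dvdp_pexp2r _ _ (ltn0Sn 1)).
by rewrite dvdp_addl // dvdp_mulr ?dvdp_exp2r in dvd.
Qed.

(** If the leading terms of the two summands cancelled, the leading
coefficient of [h] would be a quotient of squares. *)
Lemma size_sqr_comb f0 f1 h :
  (forall t : K, lead_coef h <> t ^+ 2) ->
  (size (f0 ^+ 2)%R <= size (f0 ^+ 2 + f1 ^+ 2 * h)%R)%N /\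
  (size (f1 ^+ 2 * h)%R <= size (f0 ^+ 2 + f1 ^+ 2 * h)%R)%N.
Proof.
move=> ns; set A := f0 ^+ 2; set B := f1 ^+ 2 * h.
case: (ltngtP (size A) (size B)) => sAB.
- by rewrite addrC size_polyDl // leqnn ltnW.
- by rewrite size_polyDl // leqnn ltnW.
have [f10|f10] := eqVneq f1 0.
  by rewrite /B f10 expr2 !mul0r addr0 size_poly0.
suff -> : size (A + B) = size A by rewrite sAB.
apply/eqP; rewrite eqn_leq; apply/andP; split.
  by rewrite (leq_trans (size_polyD _ _)) // -sAB maxnn.
case sA: (size A) => [//|n]; rewrite ltnNge; apply/negP => le.
have : (A + B)`_n = 0 by apply: nth_default.
have lA : A`_n = lead_coef A by rewrite lead_coefE sA.
have lB : B`_n = lead_coef B by rewrite lead_coefE -sAB sA.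
rewrite coefD lA lB /A /B [lead_coef (_ * h)]lead_coefM !lead_coef_exp => /eqP.
rewrite addr_eq0_pchar2 // => /eqP E.
apply: (ns (lead_coef f0 / lead_coef f1)).
by rewrite expr_div_n E mulrAC divff ?mul1r // expf_neq0 // lead_coef_eq0.
Qed.

End SquareCombinations.

(** * Subfields of an extension *)

Section Subfields.
Variables (K F : fieldType) (iota : {rmorphism K -> F}).
Implicit Types (E S : F -> Prop) (x u : F).

Record subfield E : Prop := Subfield {
  subfield_base : forall k, E (iota k);
  subfield_add : forall u v, E u -> E v -> E (u + v);
  subfield_opp : forall u, E u -> E (- u);
  subfield_mul : forall u v, E u -> E v -> E (u * v);
  subfield_inv : forall u, E u -> E u^-1 }.

Lemma adjoin_subfield S : subfield (adjoin iota S).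
Proof.
by split; [apply: adjoin_base | apply: adjoin_add | apply: adjoin_opp
          | apply: adjoin_mul | apply: adjoin_inv].
Qed.

Lemma adjoin_sub E S :
  subfield E -> (forall x, S x -> E x) -> forall u, adjoin iota S u -> E u.
Proof. by move=> [Eb Ea Eo Em Ei] SE u; elim=> *; auto. Qed.

Lemma subfield_exp E u n : subfield E -> E u -> E (u ^+ n).
Proof.
move=> sE Eu; elim: n => [|n IH]; last by rewrite exprS; apply: subfield_mul.
by rewrite expr0 -(rmorph1 iota); apply: subfield_base.
Qed.

Definition quadratic E (t : F) : F -> Prop :=
  fun u => exists A B, [/\ E A, E B & u = A + B * t].

Lemma quadratic_base E t u : subfield E -> E u -> quadratic E t u.
Proof.
move=> sE Eu; exists u, 0; rewrite mul0r addr0; split=> //.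
by rewrite -(rmorph0 iota); apply: subfield_base.
Qed.

Lemma quadratic_gen E t : subfield E -> quadratic E t t.
Proof.
move=> sE; exists 0, 1; rewrite mul1r add0r; split=> //.
  by rewrite -(rmorph0 iota); apply: subfield_base.
by rewrite -(rmorph1 iota); apply: subfield_base.
Qed.

Hypothesis charK2 : 2%N \in [pchar K].
Let charF2 : 2%N \in [pchar F] := rmorph_pchar iota charK2.

(** Frobenius maps a purely inseparable quadratic extension into its base, so
three steps of this kind put all eighth powers in the bottom field. *)
Lemma quadratic_sqr E t u : subfield E -> E (t ^+ 2) ->
  quadratic E t u -> E (u ^+ 2).
Proof.
move=> sE Et [A [B [EA EB ->]]]; rewrite sqrD_pchar2 // exprMn.
by apply: subfield_add => //; [|apply: subfield_mul => //];
   apply: subfield_exp.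
Qed.

Lemma quadratic_subfield E t :
  subfield E -> E (t ^+ 2) -> subfield (quadratic E t).
Proof.
move=> sE Et; have qm u v : quadratic E t u -> E v -> quadratic E t (u * v).
  move=> [A [B [EA EB ->]]] Ev; exists (A * v), (B * v).
  by split; [exact: subfield_mul | exact: subfield_mul | ring].
split.
- by move=> k; apply: quadratic_base => //; apply: subfield_base.
- move=> _ _ [A [B [EA EB ->]]] [C [D [EC ED ->]]]; exists (A + C), (B + D).
  by split; [exact: subfield_add | exact: subfield_add | ring].
- move=> _ [A [B [EA EB ->]]]; exists (- A), (- B).
  by split; [exact: subfield_opp | exact: subfield_opp | ring].
- move=> _ _ [A [B [EA EB ->]]] [C [D [EC ED ->]]].
  exists (A * C + B * D * t ^+ 2), (A * D + B * C).
  by split; [| |ring]; repeat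
    first [assumption | apply: subfield_add | apply: subfield_mul].
(* u^-1 = u / u^2, and u^2 lies in E *)
move=> u Qu; have [->|u0] := eqVneq u 0.
  rewrite invr0 -(rmorph0 iota).
  by apply: quadratic_base => //; apply: subfield_base.
have -> : u^-1 = u * (u ^+ 2)^-1 by field.
apply: qm => //; apply: subfield_inv => //; exact: quadratic_sqr Qu.
Qed.

End Subfields.

(** * Evaluation of polynomials and fields of fractions *)

Section Evaluation.
Variables (R S : comNzRingType) (h : {rmorphism R -> S}).

Definition ev (x : S) (p : {poly R}) : S := (map_poly h p).[x].

Lemma ev_is_zmod_morphism x : zmod_morphism (ev x).
Proof. by move=> p q; rewrite /ev rmorphB hornerD hornerN. Qed.

Lemma ev_is_monoid_morphism x : monoid_morphism (ev x).
Proof.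
by split=> [|p q]; rewrite /ev ?rmorph1 ?hornerE // rmorphM hornerM.
Qed.

HB.instance Definition _ x :=
  GRing.isZmodMorphism.Build {poly R} S (ev x) (ev_is_zmod_morphism x).
HB.instance Definition _ x :=
  GRing.isMonoidMorphism.Build {poly R} S (ev x) (ev_is_monoid_morphism x).

Lemma evC x k : ev x k%:P = h k.
Proof. by rewrite /ev map_polyC hornerC. Qed.

Lemma evX x : ev x 'X = x.
Proof. by rewrite /ev map_polyX hornerX. Qed.

Lemma ev0 x : ev x 0 = 0. Proof. exact: rmorph0. Qed.
Lemma ev1 x : ev x 1 = 1. Proof. exact: rmorph1. Qed.
Lemma evD x p q : ev x (p + q) = ev x p + ev x q. Proof. exact: rmorphD. Qed.
Lemma evN x p : ev x (- p) = - ev x p. Proof. exact: rmorphN. Qed.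
Lemma evM x p q : ev x (p * q) = ev x p * ev x q. Proof. exact: rmorphM. Qed.
Lemma evXn x p n : ev x (p ^+ n) = ev x p ^+ n. Proof. exact: rmorphXn. Qed.
Lemma evZ x k p : ev x (k *: p) = h k * ev x p.
Proof. by rewrite -mul_polyC evM evC. Qed.
Definition evE := (ev0, ev1, evC, evX, evXn, evZ, evD, evN, evM).

End Evaluation.

Section Fractions.
Variables (R : comNzRingType) (F : fieldType) (h : {rmorphism R -> F}).

Definition fraction_of : F -> Prop :=
  fun u => exists f g, h g != 0 /\ u * h g = h f.

Lemma fraction_of_image f : fraction_of (h f).
Proof. by exists f, 1; rewrite rmorph1 oner_eq0 mulr1. Qed.

Lemma fraction_of_subfield (K : fieldType) (iota : {rmorphism K -> F}) :
  (forall k, fraction_of (iota k)) -> subfield iota fraction_of.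
Proof.
move=> base; split=> //.
- move=> u v [f [g [g0 Eu]]] [f' [g' [g0' Ev]]].
  exists (f * g' + f' * g), (g * g'); rewrite rmorphM mulf_neq0 //; split=> //.
  by rewrite rmorphD !rmorphM -Eu -Ev; ring.
- move=> u [f [g [g0 Eu]]]; exists (- f), g.
  by rewrite g0 rmorphN -Eu mulNr.
- move=> u v [f [g [g0 Eu]]] [f' [g' [g0' Ev]]].
  exists (f * f'), (g * g'); rewrite rmorphM mulf_neq0 //; split=> //.
  by rewrite !rmorphM -Eu -Ev; ring.
move=> u [f [g [g0 Eu]]]; have [->|u0] := eqVneq u 0.
  by exists 0, 1; rewrite invr0 rmorph0 rmorph1 oner_eq0 mul0r.
by exists g, f; rewrite -Eu mulf_neq0 // mulKf.
Qed.

End Fractions.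

(** A field all of whose elements are fractions [h' f / h' g] is the fraction
field of [R] modulo the kernel of [h'], so that every morphism from [R] to a
field with the same kernel factors through it. *)
Lemma fraction_morphism (R : comNzRingType) (F F' : fieldType)
    (h : {rmorphism R -> F}) (h' : {rmorphism R -> F'}) :
  (forall p, h' p = 0 <-> h p = 0) -> (forall u, fraction_of h' u) ->
  exists phi : {rmorphism F' -> F}, forall p, phi (h' p) = h p.
Proof.
move=> ker full.
have ker_neq0 p : (h' p != 0) = (h p != 0).
  by congr (~~ _); apply/eqP/eqP => /ker.
have ex u : exists fg : R * R, (h' fg.2 != 0) && (u * h' fg.2 == h' fg.1).
  by have [f [g [g0 Eu]]] := full u; exists (f, g); rewrite g0 Eu eqxx.
pose fg u := xchoose (ex u); pose phi u := h (fg u).1 / h (fg u).2.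
have phiE u f g : h' g != 0 -> u * h' g = h' f -> phi u = h f / h g.
  move=> g0 Eu; have /andP[n0 /eqP Eu'] := xchooseP (ex u).
  rewrite -/(fg u) in n0 Eu'; rewrite /phi.
  apply/eqP; rewrite eqr_div -?ker_neq0 //; apply/eqP.
  apply: subr0_eq; rewrite -!rmorphM -rmorphB; apply/ker.
  by rewrite rmorphB !rmorphM -Eu -Eu'; ring.
have phiB : zmod_morphism phi.
  move=> u v; have [f [g [g0 Eu]]] := full u; have [f' [g' [g0' Ev]]] := full v.
  rewrite (phiE u f g) // (phiE v f' g') //.
  rewrite (phiE (u - v) (f * g' - f' * g) (g * g')).
  - move: g0 g0'; rewrite !ker_neq0 rmorphB !rmorphM => ? ?.
    by field; apply/andP.
  - by rewrite rmorphM mulf_neq0.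
  by rewrite rmorphB !rmorphM -Eu -Ev; ring.
have phiM : monoid_morphism phi.
  split=> [|u v].
    by rewrite (phiE 1 1 1) rmorph1 ?divr1 ?rmorph1 ?oner_eq0 ?mulr1.
  have [f [g [g0 Eu]]] := full u; have [f' [g' [g0' Ev]]] := full v.
  rewrite (phiE u f g) // (phiE v f' g') //.
  rewrite (phiE (u * v) (f * f') (g * g')).
  - by move: g0 g0'; rewrite !ker_neq0 !rmorphM => ? ?; field; apply/andP.
  - by rewrite rmorphM mulf_neq0.
  by rewrite !rmorphM -Eu -Ev; ring.
pose phiZ := GRing.isZmodMorphism.Build F' F phi phiB.
pose phiR := GRing.isMonoidMorphism.Build F' F phi phiM.
pose phi' : {rmorphism F' -> F} := HB.pack phi phiZ phiR.
exists phi' => p; rewrite /= (phiE _ p 1) ?rmorph1 ?oner_eq0 ?mulr1 //.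
by rewrite divr1.
Qed.

(** * Generators of a purely transcendental extension *)

Section Generators.
Variables (K F : fieldType) (iota : {rmorphism K -> F}).
Implicit Types x u : F.
Local Notation ev := (ev iota).

Definition rational_in x : F -> Prop := fraction_of (ev x).

Lemma rational_in_subfield x : subfield iota (rational_in x).
Proof.
apply: fraction_of_subfield => k; rewrite -(evC iota x).
exact: fraction_of_image.
Qed.

Lemma rational_in_gen x : rational_in x x.
Proof. by rewrite -[X in _ x X](evX iota x); apply: fraction_of_image. Qed.

Lemma rational_in_coprime x u : rational_in x u ->
  exists f g, [/\ ev x g != 0, u * ev x g = ev x f & coprimep f g].
Proof.
move=> [f [g [g0 Eu]]]; set m := gcdp f g.
have Ef : f = f %/ m * m by rewrite divpK ?dvdp_gcdl.
have Eg : g = g %/ m * m by rewrite divpK ?dvdp_gcdr.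
have [eg0 em0] : ev x (g %/ m) != 0 /\ ev x m != 0.
  by apply/andP; rewrite -negb_or -mulf_eq0 -evM -Eg.
exists (f %/ m), (g %/ m); split=> //.
  by apply: (mulIf em0); rewrite -mulrA -!evM -Eg -Ef.
apply: coprimep_div_gcd; apply/orP; right.
by apply: contraNneq g0 => ->; rewrite rmorph0.
Qed.

Definition transcendental x : Prop := forall p, ev x p = 0 -> p = 0.

(** Two generators of a purely transcendental field of degree one differ by a
Moebius transformation.  If [y = f(x)/g(x)] in lowest terms and
[x = s(y)/t(y)], homogenizing gives [sum_i s_i f^i g^(n-i) =
X * sum_i t_i f^i g^(n-i)] in [K[X]].  Modulo [g] only [i = n] survives, so
that [g] divides the linear polynomial [s_n - t_n X]; modulo [f] only [i = 0]
survives. *)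
Lemma moebius x y : transcendental x -> rational_in x y -> rational_in y x ->
  exists f g, [/\ coprimep f g, (size f <= 2)%N, (size g <= 2)%N, g != 0 &
    y * ev x g = ev x f].
Proof.
move=> trx /rational_in_coprime[f [g [g0 Ey cfg]]].
move=> /rational_in_coprime[s [t [t0 Ex cst]]].
have tn0 : t != 0 by apply: contraNneq t0 => ->; rewrite ev0.
pose n := (maxn (size s) (size t)).-1.
have szst : maxn (size s) (size t) = n.+1.
  by rewrite /n prednK // leq_max (size_poly_gt0 t) tn0 orbT.
pose H (p : {poly K}) := \sum_(i < n.+1) p`_i *: (f ^+ i * g ^+ (n - i)).
have evH (p : {poly K}) :
    (size p <= n.+1)%N -> ev x (H p) = ev y p * ev x g ^+ n.
  move=> szp; rewrite rmorph_sum /= -[ev y p]/((map_poly iota p).[y]).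
  rewrite (horner_coef_wide y (n := n.+1)); last by rewrite size_map_poly.
  rewrite mulr_suml; apply: eq_bigr => i _.
  rewrite evZ evM !evXn -Ey exprMn coef_map -!mulrA -exprD.
  by rewrite subnKC // -ltnS.
have main : H s = 'X * H t.
  apply/eqP; rewrite -subr_eq0; apply/eqP/trx; rewrite evD evN evM evX.
  rewrite !evH -?szst ?leq_maxl ?leq_maxr // -Ex.
  by rewrite -(mulrA x) subrr.
pose L (i : nat) : {poly K} := (s`_i)%:P - t`_i *: 'X.
have size_L i : (size (L i) <= 2)%N.
  rewrite (leq_trans (size_polyD _ _)) // size_polyN geq_max.
  rewrite (leq_trans (size_polyC_leq1 _)) //.
  by rewrite (leq_trans (size_scale_leq _ _)) // size_polyX.
have L_neq0 i : (s`_i != 0) || (t`_i != 0) -> L i != 0.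
  apply: contraTneq => /polyP Li0.
  have := Li0 0; have := Li0 1%N.
  rewrite !coefB !coefZ !coefX !coefC /= mulr1 mulr0 sub0r subr0.
  by move/eqP; rewrite oppr_eq0 => /eqP -> ->; rewrite eqxx.
have HL : \sum_(i < n.+1) L i * (f ^+ i * g ^+ (n - i)) = 0.
  transitivity (H s - 'X * H t); last by rewrite main subrr.
  rewrite mulr_sumr -sumrB; apply: eq_bigr => i _.
  by rewrite /L mulrBl mul_polyC -!mul_polyC; ring.
have szg : (size g <= 2)%N.
  have : g %| L n * f ^+ n.
    move/eqP: HL; rewrite big_ord_recr /= subnn expr0 mulr1 addrC addr_eq0.
    move/eqP->; rewrite dvdpNr.
    apply: (big_ind (fun p => g %| p)) => [|p q|i _];
      [exact: dvdp0 | exact: dvdp_add |].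
    by rewrite mulrA dvdp_mull // -(subnSK (ltn_ord i)) exprS dvdp_mulr.
  rewrite Gauss_dvdpl; last by rewrite coprimep_expr // coprimep_sym.
  move/(dvdp_leq _) => le; apply: leq_trans (le _) (size_L n); apply: L_neq0.
  rewrite -[n]/(n.+1.-1) -szst; case: (leqP (size s) (size t)) => c.
    by rewrite -lead_coefE lead_coef_eq0 tn0 orbT.
  rewrite -lead_coefE lead_coef_eq0 -size_poly_gt0.
  by rewrite (leq_trans _ c).
have szf : (size f <= 2)%N.
  have : f %| L 0 * g ^+ n.
    move/eqP: HL; rewrite big_ord_recl /= subn0 expr0 mul1r addr_eq0.
    move/eqP->; rewrite dvdpNr.
    apply: (big_ind (fun p => f %| p)) => [|p q|i _];
      [exact: dvdp0 | exact: dvdp_add |].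
    by rewrite dvdp_mull // dvdp_mulr // exprS dvdp_mulr.
  rewrite Gauss_dvdpl; last by rewrite coprimep_expr.
  move/(dvdp_leq _) => le; apply: leq_trans (le _) (size_L 0); apply: L_neq0.
  rewrite -negb_and; apply/negP => /andP[/eqP s0 /eqP t0'].
  have dX (p : {poly K}) : p`_0 = 0 -> 'X %| p.
    by move=> p0; rewrite -['X]subr0 -polyC0 dvdp_XsubCl /root horner_coef0 p0.
  have : 'X %| gcdp s t by rewrite dvdp_gcd !dX.
  move: cst; rewrite coprimep_def => /eqP sz1 /(dvdp_leq _).
  by rewrite -size_poly_gt0 sz1 size_polyX => /(_ isT).
by exists f, g; split=> //; apply: contraNneq g0 => ->; rewrite ev0.
Qed.

End Generators.

(** * The polynomials attached to the quartic *)

Section QuarticPolynomials.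
Variables (K : fieldType) (charK2 : 2%N \in [pchar K]) (a b c d : K).

Definition z4coef : K := b ^+ 2 * a + (c + 1) ^+ 2.
(** In a quartic function field these two polynomials take at [frobgen] the
values [z ^+ 4] and [y ^+ 8]; see [ev_z4poly] and [ev_y8poly]. *)
Definition z4poly : {poly K} :=
  z4coef^-1 *: ('X^2 + b ^+ 2 *: 'X + (b ^+ 2 * d)%:P).
Definition y8poly : {poly K} :=
  a ^+ 2 *: z4poly ^+ 2 + z4poly + 'X^2 + (d ^+ 2)%:P.
(** The fourth power of [s0 + s1 z + s2 z^2 + s3 z^3], written so that it is a
combination of two squares of such combinations. *)
Definition pow4poly (s0 s1 s2 s3 : {poly K}) : {poly K} :=
  (s0 ^+ 2 + s2 ^+ 2 * z4poly) ^+ 2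
  + (s1 ^+ 2 + s3 ^+ 2 * z4poly) ^+ 2 * z4poly.

Hypotheses (a_ns : ~ exists t, a = t ^+ 2) (b_neq0 : b != 0).

(** [z4coef] differs from [a] by a square factor and a square summand. *)
Lemma z4coef_nonsquare t : z4coef <> t ^+ 2.
Proof.
move=> E; apply: a_ns; exists ((t - (c + 1)) / b).
have -> : a = (z4coef - (c + 1) ^+ 2) / b ^+ 2 by rewrite /z4coef; field.
by rewrite E; char2_field charK2.
Qed.

Lemma z4coef_neq0 : z4coef != 0.
Proof. by apply/eqP => E; apply: (@z4coef_nonsquare 0); rewrite expr0n. Qed.

Lemma size_scaled_quadratic (k l m : K) :
  k != 0 -> size (k *: 'X^2 + l *: 'X + m%:P) = 3%N /\
            lead_coef (k *: 'X^2 + l *: 'X + m%:P) = k.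
Proof.
move=> k0; have E : k *: 'X^2 + l *: 'X + m%:P = Poly [:: m; l; k].
  by apply/polyP=> -[|[|[|i]]];
     rewrite !coefE /= ?(mulr0, mulr1, addr0, add0r) ?nth_nil.
rewrite lead_coefE E (@PolyK _ 0) //=.
Qed.

Lemma z4polyE : z4poly =
  z4coef^-1 *: 'X^2 + (b ^+ 2 / z4coef) *: 'X + (b ^+ 2 * d / z4coef)%:P.
Proof.
rewrite /z4poly !scalerDr scalerA scale_polyC.
by congr (_ + _ *: _ + _%:P); ring.
Qed.

Lemma size_z4poly : size z4poly = 3%N.
Proof.
rewrite z4polyE; apply: (size_scaled_quadratic _ _ _).1.
by rewrite invr_eq0 z4coef_neq0.
Qed.

Lemma size_y8poly : (size y8poly <= 5)%N.
Proof.
have sz2 : (size (a ^+ 2 *: z4poly ^+ 2) <= 5)%N.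
  rewrite (leq_trans (size_scale_leq _ _)) // expr2.
  by rewrite (leq_trans (size_polyMleq _ _)) // size_z4poly.
rewrite /y8poly (leq_trans (size_polyD _ _)) // geq_max.
rewrite (leq_trans (size_polyC_leq1 _)) // andbT.
rewrite (leq_trans (size_polyD _ _)) // geq_max size_polyXn andbT.
by rewrite (leq_trans (size_polyD _ _)) // geq_max sz2 size_z4poly.
Qed.

Lemma lead_z4poly_nonsquare t : lead_coef z4poly <> t ^+ 2.
Proof.
rewrite z4polyE (size_scaled_quadratic _ _ _).2 ?invr_eq0 ?z4coef_neq0 // => E.
by apply: (@z4coef_nonsquare t^-1); rewrite exprVn -E invrK.
Qed.

Lemma deriv_z4poly : z4poly^`() = (b ^+ 2 / z4coef)%:P.
Proof.
rewrite z4polyE !derivD !derivZ derivC derivX derivXn /= -alg_polyC.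
rewrite addr0 -scaler_nat scalerA.
by rewrite -[2%:R]/(2%N%:R) (pcharf0 charK2) mulr0 scale0r add0r.
Qed.

Lemma deriv_y8poly : y8poly^`() = (b ^+ 2 / z4coef)%:P.
Proof.
rewrite !derivD derivZ !deriv_sqr // derivC scaler0 add0r !addr0.
exact: deriv_z4poly.
Qed.

Lemma deriv_neq0 : b ^+ 2 / z4coef != 0.
Proof. by rewrite mulf_neq0 ?expf_neq0 ?invr_eq0 ?z4coef_neq0. Qed.

(** This is the integral closedness of [K[X][z]] with [z^4 = z4poly]: if the
fourth power of [(s0 + s1 z + s2 z^2 + s3 z^3) / g] is a polynomial, then [g]
divides each [si]. *)
Lemma dvdp_pow4poly g s0 s1 s2 s3 : g ^+ 4 %| pow4poly s0 s1 s2 s3 ->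
  [/\ g %| s0, g %| s1, g %| s2 & g %| s3].
Proof.
rewrite -[4%N]/(2 * 2)%N exprM.
case/(dvdp_sqr_comb charK2 deriv_neq0 deriv_z4poly).
move=> /(dvdp_sqr_comb charK2 deriv_neq0 deriv_z4poly)[d0 d2].
by move=> /(dvdp_sqr_comb charK2 deriv_neq0 deriv_z4poly)[d1 d3].
Qed.

Lemma pow4poly_eq0 s0 s1 s2 s3 : pow4poly s0 s1 s2 s3 = 0 ->
  [/\ s0 = 0, s1 = 0, s2 = 0 & s3 = 0].
Proof.
move=> E; have : 0 ^+ 4 %| pow4poly s0 s1 s2 s3 by rewrite E expr0n.
by case/dvdp_pow4poly; rewrite !dvd0p => /eqP-> /eqP-> /eqP-> /eqP->.
Qed.

Lemma size_sqr (p : {poly K}) : size (p ^+ 2) = (2 * size p).-1%N.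
Proof.
have [->|p0] := eqVneq p 0; first by rewrite expr0n size_poly0.
rewrite expr2 size_mul //; move: p0; rewrite -size_poly_gt0.
by move: (size p) => n; lia.
Qed.

Lemma size_sqr_z4poly (p : {poly K}) :
  size (p ^+ 2 * z4poly) = if p == 0 then 0%N else (2 * size p + 1)%N.
Proof.
case: eqP => [->|/eqP p0]; first by rewrite expr0n mul0r size_poly0.
have p20 : p ^+ 2 != 0 by rewrite expf_neq0.
rewrite size_mul // -?size_poly_gt0 size_z4poly //.
move: (size_sqr p) p0 p20; rewrite -!size_poly_gt0.
by move: (size p) (size (p ^+ 2)) => u v; lia.
Qed.

(** No leading terms cancel, so each [si ^+ 4 * z4poly ^+ i] has at most the
degree of the sum. *)
Lemma size_pow4poly n s0 s1 s2 s3 :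
  (size (pow4poly s0 s1 s2 s3) <= n.+1)%N ->
  [/\ (4 * size s0 <= n + 4)%N,
      (size s1 > 0 -> 4 * size s1 + 2 <= n + 4)%N,
      (size s2 > 0 -> 4 * size s2 + 4 <= n + 4)%N &
      (size s3 > 0 -> 4 * size s3 + 6 <= n + 4)%N].
Proof.
have [l0 l1] := size_sqr_comb charK2 (s0 ^+ 2 + s2 ^+ 2 * z4poly)
  (s1 ^+ 2 + s3 ^+ 2 * z4poly) lead_z4poly_nonsquare.
have [l00 l02] := size_sqr_comb charK2 s0 s2 lead_z4poly_nonsquare.
have [l11 l13] := size_sqr_comb charK2 s1 s3 lead_z4poly_nonsquare.
rewrite -/(pow4poly s0 s1 s2 s3) in l0 l1.
move: l0 l1 l00 l02 l11 l13.
set f := s0 ^+ 2 + _; set g := s1 ^+ 2 + _.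
rewrite !size_sqr_z4poly.
have := size_sqr f; have := size_sqr g; have := size_sqr s0.
have := size_sqr s1; rewrite -!size_poly_eq0.
move: (size s0) (size s1) (size s2) (size s3) (size f) (size g)
  (size (s0 ^+ 2)) (size (s1 ^+ 2)) (size (f ^+ 2)) (size (g ^+ 2))
  (size (pow4poly _ _ _ _)) => n0 n1 n2 n3 m0 m1 k0 k1 k2 k3 l.
by do 3 case: eqP; split; lia.
Qed.

(** Since [y8poly = (a z4poly)^2 + h] with [h = z4poly + X^2 + d^2] and the
leading coefficient [z4coef^-1 + 1] of [h] is again a nonsquare, the two squares
in [(f + a g z4poly)^2 + g^2 h] cannot cancel. *)
Lemma size_y8_comb f g :
  (size (f ^+ 2 + g ^+ 2 * y8poly)%R <= 5)%N ->
  (size g <= 2)%N /\ (size (f + a *: (g * z4poly))%R <= 3)%N.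
Proof.
pose h := z4poly + 'X^2 + (d ^+ 2)%:P.
have hE : h = (z4coef^-1 + 1) *: 'X^2 + (b ^+ 2 / z4coef) *: 'X
            + (b ^+ 2 * d / z4coef + d ^+ 2)%:P.
  rewrite /h z4polyE scalerDl scale1r polyCD -!addrA; congr (_ + _).
  by rewrite [RHS]addrCA; congr (_ + _); rewrite [RHS]addrCA.
have k0 : z4coef^-1 + 1 != 0.
  rewrite addr_eq0_pchar2 //; apply/eqP => E.
  by apply: (@z4coef_nonsquare 1); rewrite -[LHS]invrK E invr1 expr1n.
have [szh lch] := size_scaled_quadratic (b ^+ 2 / z4coef)
  (b ^+ 2 * d / z4coef + d ^+ 2) k0.
rewrite -hE in szh lch.
have ns t : lead_coef h <> t ^+ 2.
  rewrite lch => E; apply: (@z4coef_nonsquare (t + 1)^-1).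
  rewrite exprVn sqrD_pchar2 // -E expr1n -addrA.
  by rewrite [1 + 1](natr_even_pchar2 1 charK2) addr0 invrK.
have [] := size_sqr_comb charK2 (f + a *: (g * z4poly)) g ns.
have -> : (f + a *: (g * z4poly)) ^+ 2 + g ^+ 2 * h = f ^+ 2 + g ^+ 2 * y8poly.
  have charP2 : 2%N \in [pchar {poly K}] by rewrite pchar_poly.
  by rewrite /h /y8poly -!mul_polyC; char2_ring charP2.
move=> l1 l2 l3; move: (leq_trans l1 l3) (leq_trans l2 l3).
rewrite size_sqr; have [->|g0] := eqVneq g 0.
  by rewrite size_poly0; move: (size (f + _)) => n; lia.
have g20 : g ^+ 2 != 0 by rewrite expf_neq0.
have h0 : h != 0 by rewrite -size_poly_gt0 szh.
rewrite (size_mul g20 h0) szh size_sqr; move: g0; rewrite -size_poly_gt0.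
by move: (size g) (size (f + _)) => n m; lia.
Qed.

(** As [X] has twice the degree of [z] and of [y] at infinity, an eighth power
of degree at most 4 in [X] comes from an element of degree at most one, that is
from [K + K z + K y]. *)
Lemma size_pow8 s0 s1 s2 s3 t0 t1 t2 t3 :
  (size (pow4poly s0 s1 s2 s3 ^+ 2
         + pow4poly t0 t1 t2 t3 ^+ 2 * y8poly)%R <= 5)%N ->
  [/\ (size s0 <= 1)%N, (size s1 <= 1)%N & (size t0 <= 1)%N] /\
  [/\ s2 = 0, s3 = 0, t1 = 0, t2 = 0 & t3 = 0].
Proof.
case/size_y8_comb => szt szst.
have [t0s t1s t2s t3s] := size_pow4poly szt.
have [t10 t20 t30] : [/\ t1 = 0, t2 = 0 & t3 = 0].
  by split; apply/eqP; rewrite -size_poly_eq0; lia.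
have szt0 : (size t0 <= 1)%N by lia.
(* [pow4poly t0 0 0 0] is a constant, so the shift by a multiple of [z4poly]
   does not affect the bound 3. *)
have szs : (size (pow4poly s0 s1 s2 s3) <= 3)%N.
  move: szst; have [k ->] : exists k : K, pow4poly t0 t1 t2 t3 = k%:P.
    rewrite t10 t20 t30 (size1_polyC szt0) /pow4poly; exists (t0`_0 ^+ 4).
    by rewrite rmorphXn /=; ring.
  rewrite mul_polyC scalerA => sz.
  rewrite -[pow4poly s0 s1 s2 s3](addrK ((a * k) *: z4poly)).
  rewrite (leq_trans (size_polyD _ _)) // size_polyN geq_max sz.
  by rewrite (leq_trans (size_scale_leq _ _)) // size_z4poly.
have [s0s s1s s2s s3s] := size_pow4poly szs.
split; split=> //; try (by lia); by apply/eqP; rewrite -size_poly_eq0; lia.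
Qed.

End QuarticPolynomials.

(** * The tower of Frobenius subfields of a quartic function field *)

Section FrobeniusTower.
Variables (K F : fieldType) (iota : {rmorphism K -> F}).
Hypothesis charK2 : 2%N \in [pchar K].
Let charF2 : 2%N \in [pchar F] := rmorph_pchar iota charK2.

Definition adjoin_powers n : F -> Prop :=
  adjoin iota (fun x => exists t, x = t ^+ n).

(** Frobenius is a field morphism that maps constants to constants and n-th
powers to 2n-th powers. *)
Lemma adjoin_powers_sqr n u :
  adjoin_powers n u -> adjoin_powers (n * 2) (u ^+ 2).
Proof.
have sA := adjoin_subfield iota (fun x : F => exists t, x = t ^+ (n * 2)).
elim=> [k|_ [t ->]|u1 v1 _ IHu _ IHv|u1 _ IHu|u1 v1 _ IHu _ IHv|u1 _ IHu].
- by rewrite -rmorphXn; apply: adjoin_base.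
- by apply: adjoin_gen; exists t; rewrite exprM.
- by rewrite sqrD_pchar2 //; apply: adjoin_add.
- by rewrite sqrrN.
- by rewrite exprMn; apply: adjoin_mul.
by rewrite exprVn; apply: adjoin_inv.
Qed.

Variables (a b c d : K) (z y : F).
Hypothesis hF : quartic_function_field iota a b c d z y.
Let b_neq0 : b != 0. Proof. by case: hF. Qed.
Let a_ns : ~ exists t, a = t ^+ 2. Proof. by case: hF. Qed.
Let ib_neq0 : iota b != 0. Proof. by rewrite fmorph_eq0. Qed.
Local Notation z4 := (z4poly a b c d).
Local Notation y8 := (y8poly a b c d).
Local Notation pow4 := (pow4poly a b c d).

Lemma quartic_rel :
  y ^+ 4 = iota a * z ^+ 4 + iota b * y ^+ 2 + iota c * z ^+ 2
           + iota b * z + iota d.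
Proof.
by case: hF => _ _ E _ _; rewrite -[LHS]addr0 -E; char2_ring charF2.
Qed.

(** With [u = y^2 + z] and [v = z^2], which generate [K(F^4)], the equation
of the function field reads [u^2 + a v^2 + d = b u + (c+1) v]; this common value
is [frobgen].  The left-hand side shows that it lies in [K(F^8)]. *)
Definition frobgen : F := y ^+ 4 + iota a * z ^+ 4 + z ^+ 2 + iota d.
Local Notation r := frobgen.
Local Notation ev := (ev iota r).

Lemma frobgenE :
  r = iota b * y ^+ 2 + (iota c + 1) * z ^+ 2 + iota b * z.
Proof. by rewrite /frobgen quartic_rel; char2_ring charF2. Qed.

(** Both expressions of [frobgen] enter: the one free of [b] and [c] for the
linear term of [z4poly], the other one for the quadratic term. *)
Lemma ev_z4poly : ev z4 = z ^+ 4.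
Proof.
have e0 : iota (z4coef a b c) != 0 by rewrite fmorph_eq0 z4coef_neq0.
rewrite /z4poly !evE fmorphV; apply: (mulfI e0); rewrite mulVKf //.
rewrite [r ^+ 2](_ : _ =
    (iota b * y ^+ 2 + (iota c + 1) * z ^+ 2 + iota b * z) ^+ 2); last first.
  by rewrite frobgenE.
by rewrite /frobgen /z4coef; char2_ring charF2.
Qed.

Lemma ev_y8poly : ev y8 = y ^+ 8.
Proof.
have := ev_z4poly; rewrite /y8poly; move: z4 => p E.
by rewrite !evE E /frobgen; char2_ring charF2.
Qed.

Lemma adjoin_powers_exp n k u : adjoin_powers n u -> adjoin_powers n (u ^+ k).
Proof. exact: (subfield_exp k (adjoin_subfield _ _)). Qed.

Lemma adjoin_powers_pow n t : adjoin_powers n (t ^+ n).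
Proof. by apply: adjoin_gen; exists t. Qed.

(** Because [b] is nonzero, the equation expresses [z] by squares. *)
Lemma z_in_powers : adjoin_powers 2 z.
Proof.
have sA : subfield iota (adjoin_powers 2) := adjoin_subfield _ _.
have base k : adjoin_powers 2 (iota k) by apply: adjoin_base.
have y4 t : adjoin_powers 2 (t ^+ 4).
  rewrite -[4%N]/(2 * 2)%N exprM.
  exact: adjoin_powers_exp (adjoin_powers_pow _ _).
have -> : z = (y ^+ 4 + iota a * z ^+ 4 + iota b * y ^+ 2 + iota c * z ^+ 2
               + iota d) / iota b.
  by rewrite {1}quartic_rel; char2_field charF2.
by repeat first [exact: base | exact: adjoin_powers_pow | exact: y4
  | apply: adjoin_add | apply: adjoin_mul | apply: adjoin_inv].
Qed.

Lemma frobgen_in_powers : adjoin_powers 8 r.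
Proof.
have base n k : adjoin_powers n (iota k) by apply: adjoin_base.
have z4' : adjoin_powers 4 (z ^+ 2) := adjoin_powers_sqr z_in_powers.
have z8 : adjoin_powers 8 (z ^+ 4).
  by rewrite -[4%N]/(2 * 2)%N exprM; apply: adjoin_powers_sqr z4'.
have u4 : adjoin_powers 4 (y ^+ 2 + z).
  have -> : y ^+ 2 + z = (y ^+ 4 + iota a * z ^+ 4 + iota c * z ^+ 2 + iota d)
                         / iota b.
    by rewrite {1}quartic_rel; char2_field charF2.
  by repeat first [exact: base | exact: z4' | exact: adjoin_powers_pow
    | apply: adjoin_add | apply: adjoin_mul | apply: adjoin_inv].
have -> : r = (y ^+ 2 + z) ^+ 2 + iota a * z ^+ 4 + iota d.
  by rewrite /frobgen; char2_ring charF2.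
apply: adjoin_add; last exact: base.
apply: adjoin_add; last exact: adjoin_mul (base _ _) z8.
exact: adjoin_powers_sqr u4.
Qed.

(** Otherwise [z] and [y], whose powers [z^4] and [y^8] are polynomials in
[frobgen], would be algebraic over [K], and so would be all of [F]. *)
Lemma frobgen_transcendental : transcendental iota r.
Proof.
move=> p p0; apply/eqP.
apply: contra_notT (_ : ~ algebraicOver iota r) => [pn0|].
  by exists p => //; apply/eqP.
move=> algr; case: hF => [[_ [x [xtr _]]] gen _ _ _]; apply: xtr.
have algF u n : algebraicOver iota (u ^+ n.+1) -> algebraicOver iota u.
  move=> [q q0 qr]; exists (q \Po 'X^(n.+1)).
    by rewrite comp_poly_eq0 ?size_polyXn.
  by rewrite map_comp_poly map_polyXn /root horner_comp hornerXn.
have algev q : algebraicOver iota (ev q).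
  elim/poly_ind: q => [|q k IH]; first by rewrite ev0; apply: algebraic0.
  rewrite !evE; apply: algebraic_add; last exact: algebraic_id.
  exact: algebraic_mul.
have algz : algebraicOver iota z by apply: (algF _ 3%N); rewrite -ev_z4poly.
have algy : algebraicOver iota y by apply: (algF _ 7%N); rewrite -ev_y8poly.
elim: (gen x) => [k|u|u v _ IHu _ IHv|u _ IHu|u v _ IHu _ IHv|u _ IHu].
- exact: algebraic_id.
- by rewrite !inE => /orP[] /eqP->.
- exact: algebraic_add.
- exact: algebraic_opp.
- exact: algebraic_mul.
- exact: algebraic_inv.
Qed.

Lemma ev_inj p q : ev p = ev q -> p = q.
Proof.
move=> E; apply/eqP; rewrite -subr_eq0; apply/eqP/frobgen_transcendental.
by rewrite !evE E subrr.
Qed.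

(** The chain [K(F^8)], [K(F^4)], [K(F^2)], presented as a tower of purely
inseparable quadratic extensions of [K(r)]. *)
Definition frob3 := rational_in iota r.
Definition frob2 := quadratic frob3 (z ^+ 2).
Definition frob1 := quadratic frob2 z.

Lemma frob3_subfield : subfield iota frob3.
Proof. exact: rational_in_subfield. Qed.

Lemma frob3_ev p : frob3 (ev p).
Proof. exact: fraction_of_image. Qed.

Lemma frob3_z4 : frob3 ((z ^+ 2) ^+ 2).
Proof. by rewrite -exprM -ev_z4poly; apply: frob3_ev. Qed.

Lemma frob2_subfield : subfield iota frob2.
Proof. exact: (quadratic_subfield charK2 frob3_subfield frob3_z4). Qed.

Lemma frob2_z2 : frob2 (z ^+ 2).
Proof. exact: (quadratic_gen _ frob3_subfield). Qed.

Lemma frob1_subfield : subfield iota frob1.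
Proof. exact: (quadratic_subfield charK2 frob2_subfield frob2_z2). Qed.

Lemma frob1_z : frob1 z. Proof. exact: (quadratic_gen _ frob2_subfield). Qed.

Lemma frob1_y2 : frob1 (y ^+ 2).
Proof.
have sF := frob1_subfield.
have -> : y ^+ 2 = (r + (iota c + 1) * z ^+ 2) / iota b + z.
  by rewrite frobgenE; char2_field charF2.
have F1r : frob1 r.
  apply: (quadratic_base _ frob2_subfield).
  apply: (quadratic_base _ frob3_subfield).
  exact: rational_in_gen.
have Fb : forall k, frob1 (iota k) := subfield_base sF.
apply: (subfield_add sF _ frob1_z).
apply: (subfield_mul sF _ (subfield_inv sF (Fb b))).
apply: (subfield_add sF F1r).
apply: (subfield_mul sF _ (subfield_exp 2 sF frob1_z)).
rewrite -(rmorph1 iota); exact: (subfield_add sF (Fb c) (Fb 1)).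
Qed.

Lemma frob1_full x : quadratic frob1 y x.
Proof.
have sF := quadratic_subfield charK2 frob1_subfield frob1_y2.
have [_ gen _ _ _] := hF; apply: (adjoin_sub sF _ (gen x)) => u.
rewrite !inE => /orP[] /eqP->; last exact: (quadratic_gen _ frob1_subfield).
exact: (quadratic_base _ frob1_subfield frob1_z).
Qed.

Lemma frob1_sqr x : frob1 (x ^+ 2).
Proof.
exact: (quadratic_sqr charK2 frob1_subfield frob1_y2 (frob1_full x)).
Qed.

Lemma frob3_powers x : adjoin_powers 8 x -> frob3 x.
Proof.
apply: adjoin_sub frob3_subfield _ x => _ [t ->].
rewrite -[8%N]/(2 * 2 * 2)%N !exprM.
have F2t4 := quadratic_sqr charK2 frob2_subfield frob2_z2 (frob1_sqr t).
exact: (quadratic_sqr charK2 frob3_subfield frob3_z4 F2t4).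
Qed.

(** * Elements with a power in [K[r]] *)

Definition span4 (s0 s1 s2 s3 : {poly K}) : F :=
  ev s0 + ev s1 * z + ev s2 * z ^+ 2 + ev s3 * z ^+ 3.

Lemma span4_pow4 s0 s1 s2 s3 : span4 s0 s1 s2 s3 ^+ 4 = ev (pow4 s0 s1 s2 s3).
Proof.
have := ev_z4poly; rewrite /span4 /pow4poly; move: z4 => p E.
rewrite -[X in _ ^+ X = _]/(2 * 2)%N exprM !(sqrD_pchar2 charF2) !evE E.
by rewrite !(sqrD_pchar2 charF2); ring.
Qed.

Lemma span4_eq0 s0 s1 s2 s3 : span4 s0 s1 s2 s3 = 0 ->
  [/\ s0 = 0, s1 = 0, s2 = 0 & s3 = 0].
Proof.
move=> E; apply: (pow4poly_eq0 charK2 a_ns b_neq0 (c := c) (d := d)).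
by apply: frobgen_transcendental; rewrite -span4_pow4 E expr0n.
Qed.

Lemma span4_mul g s0 s1 s2 s3 :
  span4 (s0 * g) (s1 * g) (s2 * g) (s3 * g) = span4 s0 s1 s2 s3 * ev g.
Proof. by rewrite /span4 !evM; ring. Qed.

Lemma frob1_fraction x : frob1 x ->
  exists G s0 s1 s2 s3, G != 0 /\ x * ev G = span4 s0 s1 s2 s3.
Proof.
move=> [_ [_ [[A [B [FA FB ->]]] [C [D [FC FD ->]]] ->]]].
move: FA FB FC FD => [f0 [g0 [n0 E0]]] [f2 [g2 [n2 E2]]].
move=> [f1 [g1 [n1 E1]]] [f3 [g3 [n3 E3]]].
exists (g0 * g1 * g2 * g3), (f0 * (g1 * g2 * g3)), (f1 * (g0 * g2 * g3)),
  (f2 * (g0 * g1 * g3)), (f3 * (g0 * g1 * g2)).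
split; last by rewrite /span4 !evM -E0 -E1 -E2 -E3; ring.
have nz g : ev g != 0 -> g != 0 by apply: contraNneq => ->; rewrite ev0.
by rewrite !mulf_neq0 ?nz.
Qed.

(** Writing [x] as a fraction with denominator [G], the polynomial [G ^+ 4]
divides the fourth power of the numerator; by [dvdp_pow4poly], [G] cancels. *)
Lemma frob1_integral x N : frob1 x -> x ^+ 4 = ev N ->
  exists s0 s1 s2 s3, x = span4 s0 s1 s2 s3 /\ pow4 s0 s1 s2 s3 = N.
Proof.
move=> /frob1_fraction[G [s0 [s1 [s2 [s3 [G0 E]]]]]] xN.
have Gcomb : pow4 s0 s1 s2 s3 = N * G ^+ 4.
  by apply: ev_inj; rewrite -span4_pow4 -E exprMn xN evM evXn.
have dvdG : G ^+ 4 %| pow4 s0 s1 s2 s3 by rewrite Gcomb dvdp_mulIr.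
case: (dvdp_pow4poly charK2 a_ns b_neq0 dvdG).
move=> /dvdpP[u0 e0] /dvdpP[u1 e1] /dvdpP[u2 e2] /dvdpP[u3 e3].
have eG0 : ev G != 0.
  by apply: contra_neq G0 => /frobgen_transcendental.
have xE : x = span4 u0 u1 u2 u3.
  by apply: (mulIf eG0); rewrite E e0 e1 e2 e3 span4_mul.
exists u0, u1, u2, u3; split=> //.
by apply: ev_inj; rewrite -span4_pow4 -xE.
Qed.

(** The same argument with eighth powers, where [(s + t y)^8] is a combination
of two squares with [h = y8poly]. *)
Lemma F_integral x N : x ^+ 8 = ev N ->
  exists s0 s1 s2 s3 t0 t1 t2 t3,
    x = span4 s0 s1 s2 s3 + span4 t0 t1 t2 t3 * y /\
    pow4 s0 s1 s2 s3 ^+ 2 + pow4 t0 t1 t2 t3 ^+ 2 * y8 = N.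
Proof.
move=> xN.
have [A [B [/frob1_fraction FA /frob1_fraction FB xE]]] := frob1_full x.
move: FA FB => [G [s0 [s1 [s2 [s3 [G0 EA]]]]]] [H [t0 [t1 [t2 [t3 [H0 EB]]]]]].
have GH0 : G * H != 0 by rewrite mulf_neq0.
have eG0 : ev (G * H) != 0 by apply: contra_neq GH0 => /frobgen_transcendental.
have pow8 (u v : F) : (u + v * y) ^+ 8 = (u ^+ 4) ^+ 2 + (v ^+ 4) ^+ 2 * y ^+ 8.
  rewrite -[8%N]/(2 * 2 * 2)%N -[4%N]/(2 * 2)%N !exprM.
  by rewrite !sqrD_pchar2 //; ring.
have xGH : x * ev (G * H) = span4 (s0 * H) (s1 * H) (s2 * H) (s3 * H)
    + span4 (t0 * G) (t1 * G) (t2 * G) (t3 * G) * y.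
  by rewrite !span4_mul -EA -EB xE evM; ring.
have main : pow4 (s0 * H) (s1 * H) (s2 * H) (s3 * H) ^+ 2
    + pow4 (t0 * G) (t1 * G) (t2 * G) (t3 * G) ^+ 2 * y8
    = N * ((G * H) ^+ 4) ^+ 2.
  apply: ev_inj; rewrite evD [ev (_ * y8)]evM [ev (N * _)]evM !evXn.
  rewrite -!span4_pow4 ev_y8poly -pow8 -xGH.
  by rewrite exprMn xN -exprM.
have dvdGH := dvdp_mulIr N (((G * H) ^+ 4) ^+ 2); rewrite -main in dvdGH.
case: (dvdp_sqr_comb charK2 (deriv_neq0 charK2 c a_ns b_neq0)
  (deriv_y8poly charK2 a b c d) dvdGH).
case/(dvdp_pow4poly charK2 a_ns b_neq0).
move=> /dvdpP[u0 e0] /dvdpP[u1 e1] /dvdpP[u2 e2] /dvdpP[u3 e3].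
case/(dvdp_pow4poly charK2 a_ns b_neq0).
move=> /dvdpP[v0 w0] /dvdpP[v1 w1] /dvdpP[v2 w2] /dvdpP[v3 w3].
have xE' : x = span4 u0 u1 u2 u3 + span4 v0 v1 v2 v3 * y.
  apply: (mulIf eG0); rewrite xGH e0 e1 e2 e3 w0 w1 w2 w3 !span4_mul.
  by ring.
exists u0, u1, u2, u3, v0, v1, v2, v3; split=> //.
apply: ev_inj; rewrite evD [ev (_ * y8)]evM !evXn -!span4_pow4 ev_y8poly.
rewrite -pow8 -xE'; exact: xN.
Qed.

End FrobeniusTower.

(** * The isomorphisms between two quartic function fields *)

Section Coefficients.
Variables (K F : fieldType) (iota : {rmorphism K -> F}).
Hypothesis charK2 : 2%N \in [pchar K].
Let charF2 : 2%N \in [pchar F] := rmorph_pchar iota charK2.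
Variables (a b c d : K) (z y : F).
Hypothesis hF : quartic_function_field iota a b c d z y.

(** Multiplying by [b] and replacing [b y^2] by its expression in [r], [z] and
[z^2] turns the relation into one between [1], [z], [z^2] over [K[r]]. *)
Lemma quartic_monomials_free (k0 k1 k2 k4 l : K) :
  iota k4 * z ^+ 4 + iota k2 * z ^+ 2 + iota k1 * z + iota l * y ^+ 2
    + iota k0 = 0 ->
  [/\ k4 = 0, k2 = 0, k1 = 0, l = 0 & k0 = 0].
Proof.
have [_ _ _ a_ns b_neq0] := hF.
have ib_neq0 : iota b != 0 by rewrite fmorph_eq0.
move=> E; pose r := frobgen iota a d z y.
have yE : iota b * y ^+ 2 = r + (iota c + 1) * z ^+ 2 + iota b * z.
  by rewrite /r (frobgenE charK2 hF); char2_ring charF2.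
have : span4 iota a d z y
    ((b * k4) *: z4poly a b c d + l *: 'X + (b * k0)%:P)
    (b * (k1 + l))%:P (b * k2 + (c + 1) * l)%:P 0 = 0.
  have := ev_z4poly charK2 hF; rewrite /span4; move: (z4poly a b c d) => q zq.
  rewrite !evE zq -/r !(rmorphM, rmorphD, rmorph1) /=.
  transitivity (iota b * (iota k4 * z ^+ 4 + iota k2 * z ^+ 2 + iota k1 * z
      + iota k0) + iota l * (r + (iota c + 1) * z ^+ 2 + iota b * z)).
    by ring.
  by rewrite -yE -[RHS](mulr0 (iota b)) -E; ring.
case/(span4_eq0 charK2 hF) => E0 /eqP E1 /eqP E2 _.
have k40 : k4 = 0.
  move/polyP/(_ 2%N): E0; rewrite /z4poly !coefE /= !(mulr0, addr0, mulr1).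
  move/eqP; rewrite !mulf_eq0 invr_eq0.
  rewrite (negPf (z4coef_neq0 charK2 c a_ns b_neq0)).
  by rewrite (negPf b_neq0) orbF /= => /eqP.
have l0 : l = 0.
  move/polyP/(_ 1%N): E0; rewrite k40 mulr0 scale0r add0r !coefE /=.
  by rewrite mulr1 addr0.
have k00 : k0 = 0.
  move/polyP/(_ 0%N): E0; rewrite k40 l0 mulr0 !scale0r !add0r !coefE /=.
  by move/eqP; rewrite mulf_eq0 (negPf b_neq0) => /eqP.
move: E1 E2; rewrite l0 mulr0 !addr0 !polyC_eq0 !mulf_eq0 (negPf b_neq0) /=.
by move=> /eqP-> /eqP->.
Qed.

End Coefficients.

Section Isomorphism.
Variables (K : fieldType) (charK2 : 2%N \in [pchar K]).
Variables (F : fieldType) (iota : {rmorphism K -> F}) (a b c d : K) (z y : F).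
Hypothesis hF : quartic_function_field iota a b c d z y.
Variables (F' : fieldType) (iota' : {rmorphism K -> F'}) (a' b' c' d' : K).
Variables (z' y' : F').
Hypothesis hF' : quartic_function_field iota' a' b' c' d' z' y'.
Variable phi : {rmorphism F' -> F}.
Hypothesis phi_iso : K_isomorphism iota' iota phi.
Let charF2 : 2%N \in [pchar F] := rmorph_pchar iota charK2.
Local Notation r := (frobgen iota a d z y).
Local Notation r' := (frobgen iota' a' d' z' y').
Local Notation z4' := (z4poly a' b' c' d').
Local Notation y8' := (y8poly a' b' c' d').

Let phiK k : phi (iota' k) = iota k. Proof. exact: phi_iso.2. Qed.

Lemma iso_ev x p : phi (ev iota' x p) = ev iota (phi x) p.
Proof.
elim/poly_ind: p => [|p k IH]; first by rewrite !ev0 rmorph0.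
by rewrite !evE rmorphD rmorphM IH phiK.
Qed.

Lemma iso_adjoin_powers n u :
  adjoin_powers iota' n u -> adjoin_powers iota n (phi u).
Proof.
elim=> [k|_ [t ->]|u1 v1 _ IHu _ IHv|u1 _ IHu|u1 v1 _ IHu _ IHv|u1 _ IHu].
- by rewrite phiK; apply: adjoin_base.
- by rewrite rmorphXn; apply: adjoin_gen; exists (phi t).
- by rewrite rmorphD; apply: adjoin_add.
- by rewrite rmorphN; apply: adjoin_opp.
- by rewrite rmorphM; apply: adjoin_mul.
by rewrite fmorphV; apply: adjoin_inv.
Qed.

Lemma iso_rational x u :
  rational_in iota' x u -> rational_in iota (phi x) (phi u).
Proof.
move=> [f [g [g0 E]]]; exists f, g; rewrite /= -!iso_ev fmorph_eq0; split=> //.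
by rewrite -rmorphM E.
Qed.

Lemma iso_frobgen_rational : rational_in iota r (phi r').
Proof.
apply: (frob3_powers charK2 hF); apply: iso_adjoin_powers.
exact: (frobgen_in_powers charK2 hF').
Qed.

(** [r] lies in [K(F^8)], and every element of [F] is the image of one whose
eighth power is rational in [r']. *)
Lemma frobgen_rational_iso : rational_in iota (phi r') r.
Proof.
apply: adjoin_sub (rational_in_subfield _ _) _ r (frobgen_in_powers charK2 hF).
move=> _ [t ->]; have [[psi _ phiK'] _] := phi_iso.
rewrite -[t]phiK' -rmorphXn; apply: iso_rational.
apply: (frob3_powers charK2 hF').
exact: adjoin_powers_pow.
Qed.

Lemma iso_z4 : phi z' ^+ 4 = ev iota (phi r') z4'.
Proof. by rewrite -iso_ev (ev_z4poly charK2 hF') rmorphXn. Qed.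

Lemma iso_y8 : phi y' ^+ 8 = ev iota (phi r') y8'.
Proof. by rewrite -iso_ev (ev_y8poly charK2 hF') rmorphXn. Qed.

Lemma iso_z_frob1 : frob1 iota a d z y (phi z').
Proof.
have sF := frob1_subfield charK2 hF.
apply: (adjoin_sub sF) (iso_adjoin_powers (z_in_powers charK2 hF')) => _ [t ->].
exact: (frob1_sqr charK2 hF t).
Qed.

(** By [moebius], [phi r' = f(r)/g(r)] with [f] and [g] of degree at most one.
The fourth power of [phi z' * g(r)] is a polynomial [N(r)] of degree at most 4,
so that [N = s0^4 + s1^4 z4poly + s2^4 z4poly^2] with [s1] constant and [N]
has a constant derivative.  On the other hand this derivative is, up to a
nonzero constant, [g^2 (f' g + f g')].  If it is nonzero, [g] divides a nonzero
constant; if it is zero, [g] divides [f g'], hence [g']. *)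
Lemma iso_frobgen_affine :
  exists h : {poly K}, (size h <= 2)%N /\ phi r' = ev iota r h.
Proof.
have [_ _ _ a_ns b_neq0] := hF; have [_ _ _ a_ns' b_neq0'] := hF'.
have trr : transcendental iota r := frobgen_transcendental charK2 hF.
have [f [g [cfg szf szg g0 E]]] :=
  moebius trr iso_frobgen_rational frobgen_rational_iso.
suff /size_poly1P[k k0 gk] : size g == 1%N.
  exists (k^-1 *: f); split; first by rewrite (leq_trans (size_scale_leq _ _)).
  have ik0 : iota k != 0 by rewrite fmorph_eq0.
  by rewrite evZ -E gk evC fmorphV mulrCA mulVf ?mulr1.
have size1 (p : {poly K}) :
    p != 0 -> g %| p -> (size p <= 1)%N -> size g == 1%N.
  move=> p0 /(dvdp_leq p0) l1 l2; rewrite eqn_leq (leq_trans l1 l2).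
  by rewrite size_poly_gt0.
pose e := z4coef a' b' c'.
have e0 : e != 0 by apply: z4coef_neq0.
pose N := e^-1 *: (g ^+ 2 *
  (f ^+ 2 + b' ^+ 2 *: (f * g) + (b' ^+ 2 * d') *: g ^+ 2)).
have EN : (phi z' * ev iota r g) ^+ 4 = ev iota r N.
  rewrite exprMn iso_z4 /N /z4poly !evE -E -/e !(rmorphXn, rmorphM) /=.
  by ring.
have FZ : frob1 iota a d z y (phi z' * ev iota r g).
  apply: (subfield_mul (frob1_subfield charK2 hF)); first exact: iso_z_frob1.
  apply: (quadratic_base _ (frob2_subfield charK2 hF)).
  apply: (quadratic_base _ (frob3_subfield iota a d z y)).
  exact: fraction_of_image.
have [s0 [s1 [s2 [s3 [_ pow4N]]]]] := frob1_integral charK2 hF FZ EN.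
have szN : (size N <= 5)%N.
  have sq (p q : {poly K}) :
      (size p <= 2)%N -> (size q <= 2)%N -> (size (p * q)%R <= 3)%N.
    move=> lp lq; apply: leq_trans (size_polyMleq _ _) _.
    by move: (size p) (size q) lp lq => m n; lia.
  rewrite (leq_trans (size_scale_leq _ _)) //.
  have szi : (size (f ^+ 2 + b' ^+ 2 *: (f * g)
                    + (b' ^+ 2 * d') *: g ^+ 2)%R <= 3)%N.
    rewrite (leq_trans (size_polyD _ _)) // geq_max.
    rewrite (leq_trans (size_polyD _ _)) ?geq_max ?sq //=.
      by rewrite (leq_trans (size_scale_leq _ _)) // sq.
    by rewrite (leq_trans (size_scale_leq _ _)) // sq.
  apply: leq_trans (size_polyMleq _ _) _; move: szi (sq _ _ szg szg).
  by move: (size _) (size (g * g)) => m n; lia.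
rewrite -pow4N in szN.
have [_ s1_size s2_size s3_size] := size_pow4poly charK2 a_ns b_neq0 szN.
have s30 : s3 = 0 by apply/eqP; rewrite -size_poly_eq0; lia.
have [k s1k] : exists k : K, s1 = k%:P.
  by exists s1`_0; apply: size1_polyC; lia.
(* Differentiating kills all squares, so [N' = e^-1 b'^2 g^2 (f' g + f g')]. *)
have dN : g ^+ 2 * (f^`() * g + f * g^`())
    = (e / b' ^+ 2 * k ^+ 4 * (b ^+ 2 / z4coef a b c))%:P.
  have : N^`() = (pow4poly a b c d s0 s1 s2 s3)^`() by rewrite pow4N.
  rewrite /pow4poly derivD (deriv_sqr charK2) add0r s30 expr0n mul0r addr0 s1k.
  rewrite -!rmorphXn /= mul_polyC derivZ deriv_z4poly // /N derivZ.
  rewrite [(g ^+ 2 * _)^`()]derivM (deriv_sqr charK2) mul0r add0r.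
  rewrite !derivD !derivZ !(deriv_sqr charK2) scaler0 addr0 add0r derivM => D.
  transitivity ((e / b' ^+ 2) *: (e^-1 *:
      (g ^+ 2 * (b' ^+ 2 *: (f^`() * g + f * g^`()))))).
    rewrite -scalerAr !scalerA (_ : _ * _ * _ = 1) ?scale1r //.
    by field; apply/andP.
  by rewrite D scalerA scale_polyC -exprM.
have [W0|W0] := eqVneq (f^`() * g + f * g^`()) 0; last first.
  have := size_polyC_leq1 (e / b' ^+ 2 * k ^+ 4 * (b ^+ 2 / z4coef a b c)).
  rewrite -dN; apply: size1; first by rewrite mulf_neq0 ?expf_neq0.
  by rewrite expr2 -mulrA dvdp_mulIl.
have : g %| f * g^`().
  by move/eqP: W0; rewrite addrC addr_eq0 => /eqP->; rewrite dvdpNr dvdp_mulIr.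
rewrite Gauss_dvdpr; last by rewrite coprimep_sym.
move=> gg'; apply: (size1 g) => //.
have dg0 : g^`() = 0.
  apply/eqP; apply: contraTT gg' => dg0; rewrite gtNdvdp // lt_size_deriv //.
apply/leq_sizeP => -[|[|i]] // _; last first.
  by rewrite nth_default // (leq_trans szg).
by move/polyP/(_ 0%N): dg0; rewrite coef_deriv coef0.
Qed.

Lemma iso_linear : exists k0 k1 m0 m1 m2 : K,
  phi z' = iota k0 + iota k1 * z /\
  phi y' = iota m0 + iota m1 * z + iota m2 * y.
Proof.
have [_ _ _ a_ns b_neq0] := hF; have [_ _ _ a_ns' b_neq0'] := hF'.
have [h [szh rh]] := iso_frobgen_affine.
have evh p : ev iota (phi r') p = ev iota r (p \Po h).
  rewrite rh; elim/poly_ind: p => [|p k IH]; first by rewrite comp_poly0 !ev0.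
  by rewrite comp_polyD comp_polyM comp_polyX comp_polyC !evE IH.
have size_comp (p : {poly K}) n :
    (size p <= n.+1)%N -> (size (p \Po h) <= n.+1)%N.
  move=> szp; apply: leq_trans (size_comp_poly_leq _ _) _.
  by move: (size h) (size p) szh szp => i j; nia.
have [s0 [s1 [s2 [s3 [zE pow4N]]]]] :=
  frob1_integral charK2 hF iso_z_frob1 (etrans iso_z4 (evh _)).
have [s0_size s1_size s2_size s3_size] :
  [/\ (size s0 <= 1)%N, (size s1 <= 1)%N, s2 = 0 & s3 = 0].
  have szN : (size (pow4poly a b c d s0 s1 s2 s3) <= 3)%N.
    by rewrite pow4N; apply: size_comp; rewrite size_z4poly.
  have [n0 n1 n2 n3] := size_pow4poly charK2 a_ns b_neq0 szN.
  by split; try (by lia); apply/eqP; rewrite -size_poly_eq0; lia.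
have [t0 [t1 [t2 [t3 [u0 [u1 [u2 [u3 [yE pow8N]]]]]]]]] :=
  F_integral charK2 hF (etrans iso_y8 (evh _)).
have := size_comp _ 4 (size_y8poly charK2 c' d' a_ns' b_neq0').
rewrite -pow8N => /(size_pow8 charK2 a_ns b_neq0)[[t0_size t1_size u0_size]].
move=> [t20 t30 u10 u20 u30].
exists s0`_0, s1`_0, t0`_0, t1`_0, u0`_0; split.
  rewrite zE /span4 s2_size s3_size (size1_polyC s0_size) (size1_polyC s1_size).
  by rewrite !evE !coefC /=; ring.
rewrite yE /span4 t20 t30 u10 u20 u30 (size1_polyC t0_size).
rewrite (size1_polyC t1_size) (size1_polyC u0_size).
by rewrite !evE !coefC /=; ring.
Qed.

Lemma iso_parameters : exists eps beta tau gamma : K,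
  [/\ isomorphism_parameters a b c d a' b' c' d' eps beta tau gamma,
      phi z' = iota (eps ^+ 2) * (z + iota beta) &
      phi y' = iota eps * (y + iota tau + iota gamma * z)].
Proof.
have [_ _ _ a_ns b_neq0] := hF.
have [k0 [k1 [m0 [m1 [m2 [zE yE]]]]]] := iso_linear.
(* The image of the equation of [F'] is a relation between [z^4], [z^2], [z],
   [y^2] and [1] once [y^4] is eliminated; all its coefficients vanish. *)
have rel := congr1 phi (quartic_rel charK2 hF').
rewrite !(rmorphXn, rmorphD, rmorphM) !phiK zE yE /= in rel.
have [] := quartic_monomials_free charK2 hF
  (k4 := m1 ^+ 4 + a' * k1 ^+ 4 + m2 ^+ 4 * a)
  (k2 := b' * m1 ^+ 2 + c' * k1 ^+ 2 + m2 ^+ 4 * c)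
  (k1 := b' * k1 + m2 ^+ 4 * b)
  (l := b' * m2 ^+ 2 + m2 ^+ 4 * b)
  (k0 := m0 ^+ 4 + a' * k0 ^+ 4 + b' * m0 ^+ 2 + c' * k0 ^+ 2 + b' * k0 + d'
         + m2 ^+ 4 * d).
  have pow4 (u v : F) : (u + v) ^+ 4 = u ^+ 4 + v ^+ 4 by char2_ring charF2.
  move/eqP: rel; rewrite -(addr_eq0_pchar2 charF2) !pow4.
  rewrite [(iota m2 * y) ^+ 4]exprMn (quartic_rel charK2 hF) => /eqP rel.
  by rewrite -[RHS]rel !(rmorphXn, rmorphD, rmorphM) /=; char2_ring charF2.
have eqp (u v : K) : u + v = 0 -> u = v.
  by move/eqP; rewrite addr_eq0_pchar2 // => /eqP.
move=> E4 E2 /eqp E1 /eqp Ey E0.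
(* If [m2 = 0], then [k1 = 0] and [phi z'], hence [z'], would be constant. *)
have [m20|m20] := eqVneq m2 0.
  have b_neq0' : b' != 0 by case: hF'.
  have k10 : k1 = 0.
    by move/eqP: E1; rewrite m20 expr0n mul0r mulf_eq0 (negPf b_neq0') => /eqP.
  have zk : z' = iota' k0.
    by apply: (fmorph_inj phi); rewrite phiK zE k10 rmorph0 mul0r addr0.
  have [] := quartic_monomials_free charK2 hF' (k4 := 0) (k2 := 0) (k1 := 1)
    (l := 0) (k0 := - k0).
    by rewrite zk !rmorph0 rmorph1 rmorphN; ring.
  by move=> _ _ /eqP; rewrite oner_eq0.
have bE : b' = m2 ^+ 2 * b.
  by apply: (mulIf (expf_neq0 2 m20)); rewrite Ey; ring.
have k1E : k1 = m2 ^+ 2.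
  by apply: (mulfI (mulf_neq0 (expf_neq0 2 m20) b_neq0)); rewrite -bE E1 Ey.
have k0E : k0 = m2 ^+ 2 * (k0 / m2 ^+ 2) by field.
have m0E : m0 = m2 * (m0 / m2) by field.
have m1E : m1 = m2 * (m1 / m2) by field.
move: E4 E2 E0 zE yE; rewrite bE k1E k0E m0E m1E.
move: (k0 / _) (m0 / _) (m1 / _) => beta tau gamma E4 E2 E0 zE yE.
exists m2, beta, tau, gamma; split; last first.
- by rewrite yE !rmorphM; ring.
- by rewrite zE !rmorphM; ring.
have aE : m2 ^+ 4 * a' = a + gamma ^+ 4.
  apply: (mulIf (expf_neq0 4 m20)); apply: eqp; rewrite -[RHS]E4.
  by char2_ring charK2.
have cE : c' = c + gamma ^+ 2 * b.
  apply: (mulIf (expf_neq0 4 m20)); apply: eqp; rewrite -[RHS]E2.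
  by char2_ring charK2.
split=> //; first by field.
apply: (mulfI (expf_neq0 4 m20)); rewrite mulrA divff ?expf_neq0 // mul1r.
apply: eqp; rewrite -[RHS]E0 cE.
have -> : a' * (m2 ^+ 2 * beta) ^+ 4 = m2 ^+ 4 * (a + gamma ^+ 4) * beta ^+ 4.
  by rewrite -aE; ring.
by char2_ring charK2.
Qed.

End Isomorphism.

(** * Existence and uniqueness of the isomorphism with given parameters *)

Section Existence.
Variables (K : fieldType) (charK2 : 2%N \in [pchar K]) (a b c d : K).

(** Taking eighth powers is additive and turns [z] and [y] into polynomials
in [frobgen]; as [frobgen] is transcendental, whether [P(z,y)] vanishes depends
on [P] and on the constants [a], [b], [c], [d] only. *)
Lemma pow8_ev2 (P : {poly {poly K}}) : exists Q : {poly K},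
  forall (F : fieldType) (iota : {rmorphism K -> F}) (z y : F),
  quartic_function_field iota a b c d z y ->
  ev (ev iota z) y P ^+ 8 = ev iota (frobgen iota a d z y) Q.
Proof.
have pow8 (F : fieldType) (iota : {rmorphism K -> F}) (u v w : F) :
    (u * w + v) ^+ 8 = u ^+ 8 * w ^+ 8 + v ^+ 8.
  have charF2 := rmorph_pchar iota charK2.
  by rewrite -[8%N]/(2 * 2 * 2)%N !exprM !(sqrD_pchar2 charF2); ring.
elim/poly_ind: P => [|P p [Q EQ]].
  by exists 0 => F iota z y _; rewrite !ev0 expr0n.
have [q Eq] : exists q : {poly K},
    forall (F : fieldType) (iota : {rmorphism K -> F}) (z y : F),
    quartic_function_field iota a b c d z y ->
    ev iota z p ^+ 8 = ev iota (frobgen iota a d z y) q.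
  elim/poly_ind: p => [|p k [q Eq]].
    by exists 0 => F iota z y _; rewrite !ev0 expr0n.
  exists (q * z4poly a b c d ^+ 2 + (k ^+ 8)%:P) => F iota z y hF.
  rewrite evD evM evC evX (pow8 _ iota) (Eq _ _ _ _ hF) evD evM evXn evC.
  by rewrite (ev_z4poly charK2 hF) -exprM rmorphXn.
exists (Q * y8poly a b c d + q) => F iota z y hF.
rewrite evD evM evC evX (pow8 _ iota) (EQ _ _ _ _ hF) (Eq _ _ _ _ hF).
by rewrite evD evM (ev_y8poly charK2 hF).
Qed.

Lemma fraction_of_generated (F : fieldType) (iota : {rmorphism K -> F})
    (z y : F) :
  generated_by iota [:: z; y] -> forall u, fraction_of (ev (ev iota z) y) u.
Proof.
move=> gen u; have im := fraction_of_image (ev (ev iota z) y).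
have sF : subfield iota (fraction_of (ev (ev iota z) y)).
  apply: fraction_of_subfield => k.
  by have := im k%:P%:P; rewrite /= evC /= evC.
apply: (adjoin_sub sF _ (gen u)) => v; rewrite !inE => /orP[] /eqP->.
  by have := im 'X%:P; rewrite /= evC /= evX.
by have := im 'X; rewrite /= evX.
Qed.

Variables (F : fieldType) (iota : {rmorphism K -> F}) (z y : F).
Hypothesis hF : quartic_function_field iota a b c d z y.

Lemma generated_morphism_eq (F0 : fieldType) (iota0 : {rmorphism K -> F0})
    (phi psi : {rmorphism F -> F0}) :
  (forall k, phi (iota k) = iota0 k) -> (forall k, psi (iota k) = iota0 k) ->
  phi z = psi z -> phi y = psi y -> phi =1 psi.
Proof.
have [_ gen _ _ _] := hF => phiK psiK Ez Ey u.
elim: (gen u) => [k|v|v w _ IHv _ IHw|v _ IHv|v w _ IHv _ IHw|v _ IHv].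
- by rewrite phiK psiK.
- by rewrite !inE => /orP[] /eqP->.
- by rewrite !rmorphD IHv IHw.
- by rewrite !rmorphN IHv.
- by rewrite !rmorphM IHv IHw.
by rewrite !fmorphV IHv.
Qed.

Lemma quartic_morphism (F0 : fieldType) (iota0 : {rmorphism K -> F0})
    (z0 y0 : F0) :
  quartic_function_field iota0 a b c d z0 y0 ->
  exists phi : {rmorphism F -> F0},
    [/\ forall k, phi (iota k) = iota0 k, phi z = z0 & phi y = y0].
Proof.
move=> hF0; have [_ gen _ _ _] := hF.
have ker P : ev (ev iota z) y P = 0 <-> ev (ev iota0 z0) y0 P = 0.
  have [Q EQ] := pow8_ev2 P.
  have ker0 (L : fieldType) (j : {rmorphism K -> L}) (x t : L) :
      quartic_function_field j a b c d x t ->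
      ev (ev j x) t P = 0 <-> Q = 0.
    move=> hL; split=> [P0|Q0].
      apply: (frobgen_transcendental charK2 hL).
      by rewrite -(EQ _ _ _ _ hL) P0 expr0n.
    by move/eqP: (EQ _ _ _ _ hL); rewrite Q0 ev0 expf_eq0 => /eqP.
  by rewrite (ker0 _ _ _ _ hF) (ker0 _ _ _ _ hF0).
have [phi phiE] := fraction_morphism ker (fraction_of_generated gen).
exists phi; split=> [k||].
- by have := phiE k%:P%:P; rewrite /= !evC /= !evC.
- by have := phiE 'X%:P; rewrite /= !evC /= !evX.
by have := phiE 'X; rewrite /= !evX.
Qed.

End Existence.

Lemma quartic_isomorphism (K : fieldType) (charK2 : 2%N \in [pchar K])
    (a b c d : K) (F F0 : fieldType) (iota : {rmorphism K -> F})
    (iota0 : {rmorphism K -> F0}) (z y : F) (z0 y0 : F0) :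
  quartic_function_field iota a b c d z y ->
  quartic_function_field iota0 a b c d z0 y0 ->
  exists phi : {rmorphism F -> F0},
    K_isomorphism_with iota iota0 z y z0 y0 phi /\
    forall psi, K_isomorphism_with iota iota0 z y z0 y0 psi -> psi =1 phi.
Proof.
move=> hF hF0.
have [phi [phiK phiz phiy]] := quartic_morphism charK2 hF hF0.
have [psi [psiK psiz psiy]] := quartic_morphism charK2 hF0 hF.
exists phi; split; last first.
  move=> chi [[_ chiK] chiz chiy].
  by apply: (generated_morphism_eq hF chiK phiK); rewrite ?chiz ?chiy.
split=> //; split=> //; exists psi => u.
  pose comp : {rmorphism F -> F} := psi \o phi.
  by apply: (generated_morphism_eq hF (iota0 := iota) (phi := comp)
               (psi := idfun)) => [k|k||] //=; rewrite ?phiK ?phiz ?phiy.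
pose comp : {rmorphism F0 -> F0} := phi \o psi.
by apply: (generated_morphism_eq hF0 (iota0 := iota0) (phi := comp)
             (psi := idfun)) => [k|k||] //=; rewrite ?psiK ?psiz ?psiy.
Qed.

(** The conditions on the parameters say that substituting the transformed
generators in the equation with primed constants gives [eps ^+ 4] times the
equation of [z] and [y]. *)
Lemma isomorphism_parameters_quartic (K : fieldType)
    (charK2 : 2%N \in [pchar K]) (F : fieldType) (iota : {rmorphism K -> F})
    (a b c d a' b' c' d' : K)
    (z y : F) (eps beta tau gamma : K) :
  (~ exists t, a' = t ^+ 2) -> b' != 0 ->
  quartic_function_field iota a b c d z y ->
  isomorphism_parameters a b c d a' b' c' d' eps beta tau gamma ->
  quartic_function_field iota a' b' c' d' (iota (eps ^+ 2) * (z + iota beta))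
    (iota eps * (y + iota tau + iota gamma * z)).
Proof.
move=> a_ns' b_neq0' hF [eps0 aE bE cE dE].
have charF2 := rmorph_pchar iota charK2.
have ieps0 : iota eps != 0 by rewrite fmorph_eq0.
have [ff gen _ _ _] := hF.
set Z := iota (eps ^+ 2) * _; set Y := iota eps * _.
split=> //.
  pose S := fun x : F => x \in [:: Z; Y].
  have SZ : adjoin iota S Z by apply: adjoin_gen; rewrite /S mem_head.
  have SY : adjoin iota S Y by apply: adjoin_gen; rewrite /S !inE eqxx orbT.
  have Sb k : adjoin iota S (iota k) by apply: adjoin_base.
  have Sz : adjoin iota S z.
    have -> : z = iota (eps ^- 2) * Z - iota beta.
      by rewrite /Z fmorphV !rmorphXn; field.
    by apply: adjoin_add; [apply: adjoin_mul | apply: adjoin_opp].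
  have Sy : adjoin iota S y.
    have -> : y = iota eps^-1 * Y - iota tau - iota gamma * z.
      by rewrite /Y fmorphV; field.
    apply: adjoin_add; last by apply: adjoin_opp; apply: adjoin_mul.
    by apply: adjoin_add; [apply: adjoin_mul | apply: adjoin_opp].
  move=> u; apply: (adjoin_sub (adjoin_subfield iota S) _ (gen u)) => v.
  by rewrite !inE => /orP[] /eqP->.
have {}bE : b' = eps ^+ 2 * b by rewrite -bE; field.
have {}dE : d' = eps ^+ 4 * (d + beta ^+ 4 * (eps ^+ 4 * a') + beta ^+ 2 * c
    + tau ^+ 4 + (beta ^+ 2 * gamma ^+ 2 + beta + tau ^+ 2) * b).
  rewrite aE [gamma ^+ 4 + a]addrC in dE *.
  by rewrite -dE; field.
have ia : iota eps ^+ 4 * iota a' = iota a + iota gamma ^+ 4.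
  by rewrite -!rmorphXn -rmorphM aE rmorphD.
rewrite /Z /Y bE cE dE !(rmorphXn, rmorphD, rmorphM) /=.
have -> : iota a' = (iota a + iota gamma ^+ 4) / iota eps ^+ 4.
  by rewrite -ia; field.
have E := quartic_rel charK2 hF.
set ie := iota eps; set w := iota beta; set t := iota tau; set g := iota gamma.
transitivity (ie ^+ 4 * (y ^+ 4 + (iota a * z ^+ 4 + iota b * y ^+ 2
    + iota c * z ^+ 2 + iota b * z + iota d))).
  char2_field charF2.
  by [].
by rewrite E; char2_ring charF2.
Qed.

Theorem proposition4p5 (K : fieldType) (charK2 : 2%N \in [pchar K])
    (F : fieldType) (iota : {rmorphism K -> F}) (a b c d : K) (z y : F)
    (hF : quartic_function_field iota a b c d z y)
    (F' : fieldType) (iota' : {rmorphism K -> F'}) (a' b' c' d' : K)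
    (z' y' : F')
    (hF' : quartic_function_field iota' a' b' c' d' z' y') :
  ((forall phi : {rmorphism F' -> F}, K_isomorphism iota' iota phi ->
      exists eps beta tau gamma : K,
        isomorphism_parameters a b c d a' b' c' d' eps beta tau gamma /\
        phi z' = iota (eps ^+ 2) * (z + iota beta) /\
        phi y' = iota eps * (y + iota tau + iota gamma * z)) /\
   (forall eps beta tau gamma : K,
      isomorphism_parameters a b c d a' b' c' d' eps beta tau gamma ->
      exists phi : {rmorphism F' -> F},
        K_isomorphism_with iota' iota z' y'
          (iota (eps ^+ 2) * (z + iota beta))
          (iota eps * (y + iota tau + iota gamma * z)) phi /\
        forall psi : {rmorphism F' -> F},
          K_isomorphism_with iota' iota z' y'
            (iota (eps ^+ 2) * (z + iota beta))
            (iota eps * (y + iota tau + iota gamma * z)) psi ->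
          psi =1 phi)) /\
  ((forall phi : {rmorphism F -> F}, K_isomorphism iota iota phi ->
      exists beta tau : K,
        automorphism_parameters a b c beta tau /\
        phi z = z + iota beta /\ phi y = y + iota tau) /\
   (forall beta tau : K,
      automorphism_parameters a b c beta tau ->
      exists phi : {rmorphism F -> F},
        K_isomorphism_with iota iota z y (z + iota beta) (y + iota tau) phi /\
        forall psi : {rmorphism F -> F},
          K_isomorphism_with iota iota z y (z + iota beta) (y + iota tau)
            psi ->
          psi =1 phi)).
Proof.
have [_ _ _ a_ns b_neq0] := hF; have [_ _ _ a_ns' b_neq0'] := hF'.
have autP beta tau : automorphism_parameters a b c beta tau <->
    isomorphism_parameters a b c d a b c d 1 beta tau 0.
  rewrite /automorphism_parameters /isomorphism_parameters.
  rewrite oner_eq0 !expr0n !expr1n invr1 !mul1r mul0r !addr0 mulr0 !add0r.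
  have E : beta ^+ 4 * a + beta ^+ 2 * c + tau ^+ 4 + (beta + tau ^+ 2) * b
     = d + (d + beta ^+ 4 * a + beta ^+ 2 * c + tau ^+ 4
            + (beta + tau ^+ 2) * b) by char2_ring charK2.
  rewrite E; split=> [/eqP|[_ _ _ _ /eqP]]; rewrite ?addr_eq0_pchar2 //.
    by move/eqP.
  by rewrite -(addr_eq0_pchar2 charK2) => /eqP.
split; split.
- move=> phi phi_iso; have [eps [beta [tau [gamma [P Ez Ey]]]]] :=
    iso_parameters charK2 hF hF' phi_iso.
  by exists eps, beta, tau, gamma.
- move=> eps beta tau gamma P; apply: (quartic_isomorphism charK2 hF').
  exact: (isomorphism_parameters_quartic charK2 a_ns' b_neq0' hF P).
- move=> phi phi_iso; have [eps [beta [tau [gamma [P Ez Ey]]]]] :=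
    iso_parameters charK2 hF hF phi_iso.
  have [eps0 Ea Eb _ _] := P.
  have eps1 : eps = 1.
    apply: (sqr_inj_pchar2 charK2); apply: (mulIf b_neq0).
    by rewrite -{1}Eb expr1n mul1r; field.
  have gamma0 : gamma = 0.
    apply: (sqr_inj_pchar2 charK2); apply: (sqr_inj_pchar2 charK2).
    rewrite -!exprM; apply: (addrI a); rewrite -Ea eps1.
    by rewrite expr1n expr0n mul1r addr0.
  move: P Ez Ey; rewrite eps1 gamma0 expr1n !rmorph1 rmorph0 !mul1r mul0r addr0.
  by move=> /autP P Ez Ey; exists beta, tau.
move=> beta tau /autP P.
have := isomorphism_parameters_quartic charK2 a_ns b_neq0 hF P.
rewrite expr1n !rmorph1 rmorph0 !mul1r mul0r addr0.
exact: (quartic_isomorphism charK2 hF).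
Qed.
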